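(* Let $x_1\le\cdots\le x_n$ be real numbers. For all $\alpha\in(0,1)$ and any data vector $\mathcal{Y}=(Y_1,\dots,Y_n)\in\{0,1\}^n$, the following inequalities hold pointwise on $\mathbb{R}$: \[ L^{\alpha,\mathrm{YB}}\le L^{\alpha,\mathrm{nc}}\le L^{\alpha,\mathrm{raw}},\qquad U^{\alpha,\mathrm{raw}}\le U^{\alpha,\mathrm{nc}}\le U^{\alpha,\mathrm{YB}} . \]
   Context: Set $x_0:=-\infty$, $x_{n+1}:=\infty$. $N$ is the number of distinct elements of $\{x_1,\dots,x_n\}$. $\mathcal{J}$ is the set of all index pairs $(j,k)$ with $1\le j\le k\le n$, $x_{j-1}<x_j$ and $x_k<x_{k+1}$. For $1\le j\le k\le n$, $n_{jk}=k-j+1$ and $Z_{jk}=\sum_{i=j}^k Y_i$. Throughout, an infimum over the empty set is $1$ and a supremum over the empty set is $0$. Clopper–Pearson bounds: for an integer $m\ge1$, $z\in\{0,\dots,m\}$ and $\delta\in(0,1)$, $u^\delta(z,m)=\max\{\xi\in[0,1]:\mathrm{pbin}(z,m,\xi)\ge\delta\}$ and $\ell^\delta(z,m)=\min\{\xi\in[0,1]:\mathrm{pbin}(z-1,m,\xi)\le 1-\delta\}$, where $\mathrm{pbin}(\cdot,m,\xi)$ is the distribution function of the binomial distribution with parameters $m$ and $\xi$. Raw band: for $x\in\mathbb{R}$, $U^{\alpha,\mathrm{raw}}(x)=\inf_{(j,k)\in\mathcal{J}:x_j\ge x}u^{\alpha/(N^2+N)}(Z_{jk},n_{jk})$ and $L^{\alpha,\mathrm{raw}}(x)=\sup_{(j,k)\in\mathcal{J}:x_k\le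 x}\ell^{\alpha/(N^2+N)}(Z_{jk},n_{jk})$. Isotonic estimator: $\hat p:\mathbb{R}\to[0,1]$ is an isotonic (nondecreasing) function minimizing $\sum_{i=1}^n\{h(x_i)-Y_i\}^2$ over all isotonic functions $h$ with values in $[0,1]$ (it is uniquely determined on $\{x_1,\dots,x_n\}$). Non-crossing band: $L^{\alpha,\mathrm{nc}}=\min(L^{\alpha,\mathrm{raw}},\hat p)$ and $U^{\alpha,\mathrm{nc}}=\max(U^{\alpha,\mathrm{raw}},\hat p)$ pointwise. Yang–Barber band: with $Z^{\mathrm{iso}}_{jk}=\sum_{i=j}^k\hat p(x_i)$, for $x\in\mathbb{R}$, \[ U^{\alpha,\mathrm{YB}}(x)=\inf_{(j,k)\in\mathcal{J}:x_j\ge x}\Bigl[\frac{Z^{\mathrm{iso}}_{jk}}{n_{jk}}+\sqrt{\frac{\log\{(N^2+N)/\alpha\}}{2n_{jk}}}\Bigr],\quad L^{\alpha,\mathrm{YB}}(x)=\sup_{(j,k)\in\mathcal{J}:x_k\le x}\Bigl[\frac{Z^{\mathrm{iso}}_{jk}}{n_{jk}}-\sqrt{\frac{\log\{(N^2+N)/\alpha\}}{2n_{jk}}}\Bigr]. \] *)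

(* Defs.v *)
From HB Require Import structures.
From mathcomp Require Import all_boot all_order all_algebra.
From mathcomp Require Import all_classical all_reals all_analysis.

Set Implicit Arguments.
Unset Strict Implicit.
Unset Printing Implicit Defensive.
Import Order.TTheory GRing.Theory Num.Theory.
Import numFieldNormedType.Exports.
Local Open Scope classical_set_scope.
Local Open Scope ring_scope.

(* Maximum and minimum of a set of reals: an element of the set that bounds it.
   The value is 0 when there is none; [cp_upperP] and [cp_lowerP] below show
   that this does not happen for the sets used here. *)
Definition set_max (R : realType) (A : set R) : R := xget 0 (A `&` ubound A).
Definition set_min (R : realType) (A : set R) : R := xget 0 (A `&` lbound A).

(* The argument c is real, so that pbin (z%:R - 1) is meaningful (and 0) at
   z = 0, unlike with truncated subtraction on nat. *)
Definition pbin (R : realType) (c : R) (m : nat) (xi : R) : R :=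
  fine (binomial_prob m xi [set k : nat | k%:R <= c]).

Definition cp_upper_set (R : realType) (delta : R) (z m : nat) : set R :=
  [set xi | 0 <= xi <= 1 /\ delta <= pbin z%:R m xi].
Definition cp_lower_set (R : realType) (delta : R) (z m : nat) : set R :=
  [set xi | 0 <= xi <= 1 /\ pbin (z%:R - 1) m xi <= 1 - delta].

Definition cp_upper (R : realType) (delta : R) (z m : nat) : R :=
  set_max (cp_upper_set delta z m).
Definition cp_lower (R : realType) (delta : R) (z m : nat) : R :=
  set_min (cp_lower_set delta z m).

Section Bands.
Variables (R : realType) (n : nat) (x : 'I_n -> R) (Y : 'I_n -> bool).

(* The points x_0 = -oo, x_1, ..., x_n, x_(n+1) = +oo. The mathematical indices
   start at 1 and ordinals at 0, so i : 'I_n carries x_(i+1). *)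
Definition xbar (i : nat) : \bar R :=
  match i with
  | 0 => -oo%E
  | i'.+1 => if insub i' is Some i0 then (x i0)%:E else +oo%E
  end.

Definition ndistinct : nat := size (undup (codom x)).

(* The pair of ordinals (j, k) stands for the index pair (j+1, k+1). *)
Definition Jset : set ('I_n * 'I_n) :=
  [set jk : 'I_n * 'I_n | [/\ (jk.1 <= jk.2)%N,
      (xbar jk.1 < xbar jk.1.+1)%E &
      (xbar jk.2.+1 < xbar jk.2.+2)%E]].

Definition nobs (j k : 'I_n) : nat := (k - j + 1)%N.

Definition Zsum (j k : 'I_n) : nat := (\sum_(i < n | j <= i <= k) Y i)%N.

Definition Nfactor : R := (ndistinct ^ 2 + ndistinct)%:R.

(* [infimum 1] and [supremum 0] are 1 and 0 on the empty set. *)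
Definition U_raw (alpha t : R) : R :=
  infimum 1 [set cp_upper (alpha / Nfactor) (Zsum jk.1 jk.2) (nobs jk.1 jk.2)
            | jk in [set jk | Jset jk /\ t <= x jk.1]].
Definition L_raw (alpha t : R) : R :=
  supremum 0 [set cp_lower (alpha / Nfactor) (Zsum jk.1 jk.2) (nobs jk.1 jk.2)
             | jk in [set jk | Jset jk /\ x jk.2 <= t]].

Definition isotonic01 (h : R -> R) : Prop :=
  {homo h : s t / s <= t} /\ (forall t, 0 <= h t <= 1).

Definition sq_loss (h : R -> R) : R := \sum_(i < n) (h (x i) - (Y i)%:R) ^+ 2.

Definition isotonic_estimator (p : R -> R) : Prop :=
  isotonic01 p /\ (forall h, isotonic01 h -> sq_loss p <= sq_loss h).

Definition L_nc (p : R -> R) (alpha t : R) : R := Num.min (L_raw alpha t) (p t).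
Definition U_nc (p : R -> R) (alpha t : R) : R := Num.max (U_raw alpha t) (p t).

Definition Ziso (p : R -> R) (j k : 'I_n) : R :=
  \sum_(i < n | (j <= i <= k)%N) p (x i).

Definition YB_radius (alpha : R) (m : nat) : R :=
  Num.sqrt (ln (Nfactor / alpha) / (2 * m%:R)).

Definition U_YB (p : R -> R) (alpha t : R) : R :=
  infimum 1 [set Ziso p jk.1 jk.2 / (nobs jk.1 jk.2)%:R
                   + YB_radius alpha (nobs jk.1 jk.2)
            | jk in [set jk | Jset jk /\ t <= x jk.1]].
Definition L_YB (p : R -> R) (alpha t : R) : R :=
  supremum 0 [set Ziso p jk.1 jk.2 / (nobs jk.1 jk.2)%:R
                   - YB_radius alpha (nobs jk.1 jk.2)
             | jk in [set jk | Jset jk /\ x jk.2 <= t]].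

End Bands.

Section ClopperPearsonAttained.
Variable R : realType.
Implicit Types (c delta xi : R) (z m : nat).

Let pbin_poly c m : {poly R} :=
  \sum_(k < m.+1 | k%:R <= c) ('X^k * (1 - 'X) ^+ (m - k)) *+ 'C(m, k).

Lemma pbinE c m xi : 0 <= xi <= 1 ->
  pbin c m xi = \sum_(k < m.+1 | k%:R <= c) binomial_pmf m xi k.
Proof.
move=> /andP[xi0 xi1]; rewrite /pbin binomial_probE//.
rewrite (eq_bigr (fun k : 'I_m.+1 =>
  (if k%:R <= c then binomial_pmf m xi k else 0)%:E)).
  by rewrite sumEFin /= -big_mkcond.
move=> k _; rewrite /= diracE; case: ifPn => kc.
  by rewrite mem_set//= mule1.
by rewrite memNset ?mule0//=; exact/negP.
Qed.

Let pbin_polyE c m xi : 0 <= xi <= 1 -> pbin c m xi = (pbin_poly c m).[xi].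
Proof.
move=> xi01; rewrite pbinE// horner_sum; apply: eq_bigr => k _.
by rewrite hornerMn !hornerE /binomial_pmf.
Qed.

Let compact_preim c m (C : set R) : closed C ->
  compact [set xi | 0 <= xi <= 1 /\ C (pbin c m xi)].
Proof.
move=> cC.
have -> : [set xi | 0 <= xi <= 1 /\ C (pbin c m xi)] =
    `[0, 1]%classic `&` (horner (pbin_poly c m) @^-1` C).
  apply/seteqP; split=> xi /=; rewrite in_itv/= => -[xi01];
    by rewrite pbin_polyE.
apply: compact_closedI; first exact: segment_compact.
by apply: preimage_closed => // xi _; exact: continuous_horner.
Qed.

Lemma cp_upperP delta z m : delta < 1 ->
  cp_upper_set delta z m (cp_upper delta z m) /\
  ubound (cp_upper_set delta z m) (cp_upper delta z m).
Proof.
move=> d1; suff /cid[a Sa] :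
    exists a, (cp_upper_set delta z m `&` ubound (cp_upper_set delta z m)) a.
  exact: (xgetPex 0 (ex_intro _ a Sa)).
have S0 : cp_upper_set delta z m !=set0.
  exists 0; rewrite /cp_upper_set/= lexx ler01; split=> //.
  rewrite pbinE ?lexx ?ler01// big_mkcond big_ord_recl /= ler0n.
  rewrite /binomial_pmf /unstable.onem expr0 mul1r !subn0.
  rewrite bin0 mulr1n subr0 expr1n.
  rewrite big1 ?addr0 ?ltW// => i _; case: ifP => // _.
  by rewrite expr0n /= mul0r mul0rn.
have [a Sa aM] := @compact_EVT_max R R id _ S0
  (@compact_preim z%:R m _ (@closed_ge _ delta)) (continuous_subspaceT (fun x => @cvg_id _ (nbhs x))).
by exists a; split=> [|y /mem_set/aM//]; exact: set_mem.
Qed.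

Lemma cp_lowerP delta z m : delta < 1 -> (z <= m)%N ->
  cp_lower_set delta z m (cp_lower delta z m) /\
  lbound (cp_lower_set delta z m) (cp_lower delta z m).
Proof.
move=> d1 zm; suff /cid[a Sa] :
    exists a, (cp_lower_set delta z m `&` lbound (cp_lower_set delta z m)) a.
  exact: (xgetPex 0 (ex_intro _ a Sa)).
have S0 : cp_lower_set delta z m !=set0.
  exists 1; rewrite /cp_lower_set/= lexx ler01; split=> //.
  rewrite pbinE ?lexx ?ler01// big1 ?subr_ge0 ?ltW// => i iz.
  have im : (i < m)%N.
    by move: iz; rewrite lerBrDr natr1 ler_nat => /leq_trans; exact.
  rewrite /binomial_pmf /unstable.onem subrr expr0n subn_eq0 leqNgt im/=.
  by rewrite mulr0 mul0rn.
have [a Sa am] := @compact_EVT_min R R id _ S0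
  (@compact_preim (z%:R - 1) m _ (@closed_le _ (1 - delta))) (continuous_subspaceT (fun x => @cvg_id _ (nbhs x))).
by exists a; split=> [|y /mem_set/am//]; exact: set_mem.
Qed.

End ClopperPearsonAttained.

(* Main.v *)
(* Both raw Clopper-Pearson bounds lie within Hoeffding's radius of the raw mean,
   so it suffices to bound every Yang-Barber term from below by the Hoeffding
   bound of a raw mean over another admissible pair. Fix (j, k). If the right end
   of an interval starting at j is moved inside the level block of phat containing
   k, the sum of phat has the form A + c m, with m the length, c the level of the
   block and A <= 0; hence the Yang-Barber term A / m + c + r / sqrt m is concave
   in 1 / sqrt m, and is minimal when the right end is the last index of that block
   or of the preceding one. At such an index the raw sum is at most the sum of
   phat, by optimality of phat under a perturbation that raises it on the
   interval. The lower band is symmetric. *)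
Require Import Defs.
From HB Require Import structures.
From mathcomp Require Import all_boot all_order all_algebra.
From mathcomp Require Import all_classical all_reals all_analysis.
From mathcomp Require Import ring lra zify.
Set Implicit Arguments.
Unset Strict Implicit.
Import Order.TTheory GRing.Theory Num.Theory.
Import numFieldNormedType.Exports.
Local Open Scope classical_set_scope.
Local Open Scope ring_scope.

(** * Hoeffding's inequality for binomial tails *)

Lemma nondecreasing_of_derive_ge0 (R : realType) (f df : R -> R) (a b : R) : a <= b ->
  (forall x, is_derive x (1 : R) f (df x)) ->
  (forall x, a <= x -> x <= b -> 0 <= df x) -> f a <= f b.
Proof.
move=> ab dfP df0; rewrite -subr_ge0.
have cf : {within `[a, b], continuous f}.
  apply: continuous_subspaceT => x.
  by apply/differentiable_continuous/derivable1_diffP; exact: ex_derive.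
have [c + ->] := MVT_segment ab (fun x _ => dfP x) cf.
by rewrite in_itv/= => /andP[ac cb]; rewrite mulr_ge0 ?subr_ge0 ?df0.
Qed.

Section HoeffdingLemma.
Variables (R : realType) (p : R).
Hypothesis p01 : 0 <= p <= 1.

Let mgf (s : R) : R := 1 - p + p * expR s.

Let mgf_gt0 s : 0 < mgf s.
Proof.
have [p0 p1] := andP p01; have e0 := expR_gt0 s; rewrite /mgf.
have [->|pN0] := eqVneq p 0; first by lra.
have {}p0 : 0 < p by rewrite lt_def pN0.
have := mulr_gt0 p0 e0; lra.
Qed.

Let is_derive_mgf (s : R) : is_derive s (1 : R) mgf (p * expR s).
Proof.
apply: is_derive_eq; rewrite /GRing.scale/=; ring.
Qed.

(** The gap between the exponent on the right and the logarithm of the left side vanishes at 0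
    together with its derivative, and is convex. *)
Lemma bernoulli_mgf_le_pos (s : R) : 0 <= s ->
  1 - p + p * expR s <= expR (p * s + s ^+ 2 / 8).
Proof.
move=> s0.
(* The second derivative of [F] is 1/4 - q (1 - q) with q = p expR u / mgf u. *)
pose F (u : R) := p * u + u ^+ 2 / 8 - ln (mgf u).
pose dF (u : R) := p + u / 4 - p * expR u / mgf u.
pose ddF (u : R) := 4^-1 - (1 - p) * (p * expR u) / mgf u ^+ 2.
have mgfN0 u : mgf u != 0 by rewrite gt_eqF.
have dFP u : is_derive u (1 : R) F (dF u).
  have H := is_derive1_comp (is_derive1_ln (mgf_gt0 u)) (is_derive_mgf u).
  by apply: is_derive_eq; rewrite /GRing.scale/= /dF; field.
have ddFP u : is_derive u (1 : R) dF (ddF u).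
  have H := is_deriveV (mgfN0 u) (is_derive_mgf u).
  apply: is_derive_eq; rewrite /GRing.scale/= /ddF.
  have -> : 1 - p = mgf u - p * expR u by rewrite /mgf; ring.
  field.
  by rewrite mgfN0.
have ddF0 u : 0 <= ddF u.
  rewrite subr_ge0 ler_pdivrMr ?exprn_gt0//.
  (* This is 4 a b <= (a + b)^2 with a = 1 - p and b = p exp u, where a + b = [mgf u]. *)
  have := sqr_ge0 (1 - p - p * expR u); rewrite /mgf; lra.
have F0 : F 0 = 0 by rewrite /F /mgf expR0 mulr1 subrK ln1; ring.
have dF0 : dF 0 = 0 by rewrite /dF /mgf expR0 mulr1 subrK; field.
have dF_ge0 u : 0 <= u -> 0 <= dF u.
  by move=> u0; rewrite -dF0; exact: nondecreasing_of_derive_ge0 u0 ddFP _.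
have : 0 <= F s by rewrite -F0; apply: nondecreasing_of_derive_ge0 s0 dFP _ => u u0 _; exact: dF_ge0.
rewrite subr_ge0 => ln_le; have := mgf_gt0 s.
by rewrite -posrE => /lnK; rewrite /mgf => <-; rewrite ler_expR.
Qed.

End HoeffdingLemma.

(** Exchanging success and failure, that is p with 1 - p and s with - s, reduces negative s to the
    previous case once exp s is factored out. *)
Lemma bernoulli_mgf_le (R : realType) (p s : R) : 0 <= p <= 1 ->
  1 - p + p * expR s <= expR (p * s + s ^+ 2 / 8).
Proof.
move=> p01; have [s0|/ltW s0] := leP 0 s; first exact: bernoulli_mgf_le_pos.
have q01 : 0 <= 1 - p <= 1 by lra.
have Ns0 : 0 <= - s by rewrite oppr_ge0.
have := bernoulli_mgf_le_pos q01 Ns0.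
rewrite -(ler_pM2l (expR_gt0 s)) -expRD mulrDr mulrCA -expRD subrr expR0.
suff -> : s + ((1 - p) * - s + (- s) ^+ 2 / 8) = p * s + s ^+ 2 / 8 by lra.
ring.
Qed.

(** On [P] the weight exp (s (k - z)) is at least 1, and the binomial theorem evaluates the fully
    weighted sum. The sign condition lets positive s treat upper tails and negative s lower
    tails. *)
Lemma binomial_chernoff (R : realType) (P : nat -> bool) (m z : nat) (p s : R) :
  0 <= p <= 1 -> (forall k, P k -> 0 <= s * (k%:R - z%:R)) ->
  \sum_(k < m.+1 | P k) binomial_pmf m p k
    <= expR (m%:R * (p * s + s ^+ 2 / 8) - s * z%:R).
Proof.
move=> /andP[p0 p1] Ps.
have pmf0 (k : 'I_m.+1) : 0 <= binomial_pmf m p k.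
  by rewrite /binomial_pmf mulrn_wge0// mulr_ge0// exprn_ge0// subr_ge0.
apply: (@le_trans _ _ (\sum_(k < m.+1) binomial_pmf m p k * expR (s * (k%:R - z%:R)))).
  rewrite big_mkcond/=; apply: ler_sum => k _; case: ifPn => Pk.
    by rewrite ler_peMr// (le_trans _ (expR_ge1Dx _))// lerDl Ps.
  by rewrite mulr_ge0// expR_ge0.
have -> : \sum_(k < m.+1) binomial_pmf m p k * expR (s * (k%:R - z%:R)) =
    (1 - p + p * expR s) ^+ m * expR (- (s * z%:R)).
  rewrite exprDn mulr_suml; apply: eq_bigr => k _.
  rewrite mulrBr expRD mulrA [s * k%:R]mulrC expRM_natl /binomial_pmf /unstable.onem.
  by rewrite exprMn mulrnAl; congr (_ *+ _ * _); ring.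
rewrite expRD ler_pM2r ?expR_gt0// expRM_natl.
apply: lerXn2r; rewrite ?nnegrE ?expR_ge0 ?bernoulli_mgf_le ?p0//.
by rewrite addr_ge0 ?subr_ge0// mulr_ge0// expR_ge0.
Qed.

(** The tail bound is inverted: a tail of mass at least d forces p close to z / m. The sign
    condition says that [P] selects only counts lying beyond z as seen from m p. *)
Lemma hoeffding_binomial (R : realType) (P : nat -> bool) (m z : nat) (p d : R) :
  0 < d -> (0 < m)%N -> 0 <= p <= 1 ->
  (forall k, P k -> 0 <= (z%:R / m%:R - p) * (k%:R - z%:R)) ->
  d <= \sum_(k < m.+1 | P k) binomial_pmf m p k ->
  `|p - z%:R / m%:R| <= Num.sqrt (ln d^-1 / (2 * m%:R)).
Proof.
move=> d0 m0 p01 Ps dle.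
have m0' : 0 < m%:R :> R by rewrite ltr0n.
set e := z%:R / m%:R - p.
(* [4 * e] optimizes the exponent of the Chernoff bound. *)
have := le_trans dle (@binomial_chernoff _ P m z _ (4 * e) p01 _).
move=> /(_ _)/wrap[k Pk|]; first by rewrite -mulrA mulr_ge0// Ps.
have -> : m%:R * (p * (4 * e) + (4 * e) ^+ 2 / 8) - 4 * e * z%:R = - (2 * m%:R * e ^+ 2).
  by rewrite /e; field; rewrite gt_eqF.
rewrite -ler_ln ?posrE ?expR_gt0// expRK => dle'.
rewrite distrC -sqrtr_sqr ler_sqrt ?ler_pdivlMr ?lnV ?posrE// ?mulr_gt0//.
  rewrite -/e; lra.
have := mulr_ge0 (ltW m0') (sqr_ge0 e); lra.
Qed.

(** * Clopper-Pearson bounds lie within Hoeffding's radius of the mean *)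

Lemma cp_upper_le (R : realType) (d : R) (z m : nat) :
  0 < d < 1 -> (0 < m)%N ->
  0 <= cp_upper d z m <= z%:R / m%:R + Num.sqrt (ln d^-1 / (2 * m%:R)).
Proof.
move=> /andP[d0 d1] m0.
have [[/andP[u0 u1]] + _] := cp_upperP z m d1.
rewrite u0/= pbinE ?u0// => du.
(* Only a bound above the mean needs the tail inequality; the counts up to z are then the far tail,
   of mass at least d by [du]. *)
have [|zu] := leP (cp_upper d z m) (z%:R / m%:R).
  by move=> /le_trans; apply; rewrite lerDl sqrtr_ge0.
have u01 : 0 <= cp_upper d z m <= 1 by rewrite u0.
rewrite -lerBlDl (le_trans (ler_norm _))//.
apply: (@hoeffding_binomial _ (fun k => k%:R <= z%:R :> R)) => // k kz.
by rewrite mulr_le0// subr_le0// ltW.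
Qed.

(** At the lower bound the counts up to z - 1 have mass at most 1 - d, so the complementary tail of
    counts from z on has mass at least d. *)
Lemma cp_lower_ge (R : realType) (d : R) (z m : nat) :
  0 < d < 1 -> (0 < m)%N -> (z <= m)%N ->
  z%:R / m%:R - Num.sqrt (ln d^-1 / (2 * m%:R)) <= cp_lower d z m <= 1.
Proof.
move=> /andP[d0 d1] m0 zm.
have [[/andP[l0 l1]] + _] := cp_lowerP d1 zm.
have l01 : 0 <= cp_lower d z m <= 1 by rewrite l0.
rewrite l1 andbT pbinE// => ld.
have [|lz] := leP (z%:R / m%:R) (cp_lower d z m).
  by apply: le_trans; rewrite gerBl sqrtr_ge0.
suff : `|cp_lower d z m - z%:R / m%:R| <= Num.sqrt (ln d^-1 / (2 * m%:R)).
  by rewrite ler_norml => /andP[+ _]; lra.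
apply: (@hoeffding_binomial _ (fun k => ~~ (k%:R <= z%:R - 1 :> R))) => // [k|].
  rewrite lerBrDr natr1 ler_nat -leqNgt => zk.
  by rewrite mulr_ge0// subr_ge0 ?ler_nat// ltW.
have -> : \sum_(k < m.+1 | ~~ (k%:R <= z%:R - 1 :> R)) binomial_pmf m (cp_lower d z m) k
   = 1 - \sum_(k < m.+1 | k%:R <= z%:R - 1 :> R) binomial_pmf m (cp_lower d z m) k.
  have : \sum_(k < m.+1) binomial_pmf m (cp_lower d z m) k = 1.
    rewrite -(expr1n _ m) -(subrK (cp_lower d z m) 1) exprDn.
    by apply: eq_bigr => k _; rewrite /binomial_pmf /unstable.onem mulrC.
  by rewrite (bigID (fun k : 'I_m.+1 => k%:R <= z%:R - 1 :> R))/=; lra.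
lra.
Qed.

(** * Optimal endpoints for means of a monotone sequence *)

Lemma sum_itv_extend (V : nmodType) (n : nat) (F : 'I_n -> V) (j a b : nat) :
  (a <= b)%N -> (forall i : 'I_n, (a < i <= b)%N -> F i = 0) ->
  \sum_(i < n | (j <= i <= b)%N) F i = \sum_(i < n | (j <= i <= a)%N) F i.
Proof.
move=> ab F0; rewrite big_mkcond [RHS]big_mkcond; apply: eq_bigr => i _.
have [ji|] //= := leqP j i; have [ia|ai] := leqP i a; first by rewrite (leq_trans ia).
by case: ifP => // ib; rewrite F0// ai.
Qed.

Lemma card_ord_itv (n : nat) (j k : 'I_n) : (j <= k)%N ->
  (\sum_(i < n | j <= i <= k) 1 = nobs j k)%N.
Proof.
move=> jk; have : (\sum_(j <= i < k.+1) 1 = nobs j k)%N.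
  by rewrite sum_nat_const_nat muln1 /nobs subSn// addn1.
rewrite (big_nat_widenl j 0%N)// (big_nat_widen _ _ n) ?ltn_ord// big_mkord => <-.
by apply: eq_bigl => i; rewrite ltnS.
Qed.

(** In the variable y = 1 / sqrt l the function is A y^2 + r y, which is concave; a concave function
    on an interval is at least the smaller of its two end values. *)
Lemma radius_concave (R : realType) (A L : R) (m1 m m2 : nat) :
  A <= 0 -> (0 < m1 <= m)%N -> (m <= m2)%N ->
  let f (l : nat) := A / l%:R + Num.sqrt (L / (2 * l%:R)) in
  f m1 <= f m \/ f m2 <= f m.
Proof.
move=> A0 /andP[m10 m1m] mm2 f.
have m0 := leq_trans m10 m1m; have m20 := leq_trans m0 mm2.
pose y (l : nat) : R := Num.sqrt l%:R^-1.
have fE l : f l = A * y l ^+ 2 + Num.sqrt (L / 2) * y l.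
  rewrite /f /y sqr_sqrtr ?invr_ge0//; congr (_ + _).
  by rewrite invfM mulrA [_ * l%:R^-1]mulrC sqrtrM ?invr_ge0// mulrC.
have y_le l l' : (0 < l)%N -> (l <= l')%N -> y l' <= y l.
  move=> l0 ll'; rewrite ler_wsqrtr// lef_pV2 ?ler_nat ?posrE ?ltr0n//.
  exact: leq_trans l0 ll'.
have := y_le _ _ m10 m1m; have := y_le _ _ m0 mm2; rewrite !fE.
set r := Num.sqrt (L / 2); set y1 := y m1; set y2 := y m2; set y0 := y m.
move=> y20 y01.
have [|f1] := leP (A * y1 ^+ 2 + r * y1) _; first by left.
have [|f2] := leP (A * y2 ^+ 2 + r * y2) _; first by right.
exfalso.
(* If both end values exceeded the middle one, the chord from y0 to y1 would have positive slope and
   the one from y2 to y0 negative slope; the difference of the slopes is A (y1 - y2), which is at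
   most 0. *)
have h1 : 0 < (y1 - y0) * (A * (y1 + y0) + r) by lra.
have h2 : 0 < (y0 - y2) * - (A * (y2 + y0) + r) by lra.
have pos_factor (u v : R) : 0 <= u -> 0 < u * v -> 0 < v.
  by rewrite le0r => /orP[/eqP->|u0]; rewrite ?mul0r ?ltxx// pmulr_rgt0.
have : 0 < A * (y1 + y0) + r by apply: pos_factor h1; rewrite subr_ge0.
have : 0 < - (A * (y2 + y0) + r) by apply: pos_factor h2; rewrite subr_ge0.
have : A * (y1 - y2) <= 0 by rewrite mulr_le0_ge0//; lra.
lra.
Qed.

Lemma mean_radius_block_end (R : realType) (n : nat) (p : 'I_n -> R) (L : R)
    (j k : 'I_n) :
  (forall i i' : 'I_n, (i <= i')%N -> p i <= p i') -> (j <= k)%N ->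
  let f (l : 'I_n) := (\sum_(i < n | (j <= i <= l)%N) p i) / (nobs j l)%:R
    + Num.sqrt (L / (2 * (nobs j l)%:R)) in
  exists2 l : 'I_n, (j <= l)%N /\ (forall i : 'I_n, (l < i)%N -> p l < p i)
    & f l <= f k.
Proof.
move=> p_homo jk f; pose c := p k.
(* Centring at the level [c] of k makes the terms of its block vanish, so [A] takes the same value
   at k, at the end [l] of its block and at the end [s] of the preceding one. *)
pose A (l : 'I_n) := \sum_(i < n | (j <= i <= l)%N) (p i - c).
have nobs_gt0 (l : 'I_n) : (0 < nobs j l)%N by rewrite /nobs addn1.
have nobs_le (l l' : 'I_n) : (l <= l')%N -> (nobs j l <= nobs j l')%N.
  by move=> ll'; rewrite leq_add2r leq_sub2r.
have fE (l : 'I_n) : (j <= l)%N ->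
    f l = A l / (nobs j l)%:R + Num.sqrt (L / (2 * (nobs j l)%:R)) + c.
  move=> jl; have cE : \sum_(i < n | (j <= i <= l)%N) c = c * (nobs j l)%:R.
    rewrite -card_ord_itv// natr_sum mulr_sumr.
    by apply: eq_bigr => i _; rewrite mulr1.
  by rewrite /f /A sumrB cE; field; rewrite pnatr_eq0 -lt0n.
have [l /eqP pl lmax] : exists2 l : 'I_n, p l == c & forall i, p i == c -> (i <= l)%N.
  by case: (@arg_maxnP _ k (fun i => p i == c) (@nat_of_ord n) (eqxx c)) => l; exists l.
have kl : (k <= l)%N by exact: lmax.
have jl := leq_trans jk kl.
have l_end : forall i : 'I_n, (l < i)%N -> p l < p i.
  move=> i li; rewrite lt_neqAle p_homo 1?ltnW// andbT pl eq_sym.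
  by apply: contraL li => /lmax; rewrite leqNgt.
have Al : A l = A k.
  apply: sum_itv_extend kl _ => i /andP[/ltnW/p_homo ki /p_homo].
  by rewrite pl => il; apply/eqP; rewrite subr_eq0 eq_le il.
have A_le0 : A k <= 0.
  by apply: sumr_le0 => i /andP[_ ik]; rewrite subr_le0 p_homo.
have [[i0 /andP[ji0 pi0]]|none] := pselect (exists i : 'I_n, (j <= i)%N && (p i < c)).
  have [s /andP[js ps] smax] : exists2 s : 'I_n, (j <= s)%N && (p s < c) &
      forall i : 'I_n, (j <= i)%N && (p i < c) -> (i <= s)%N.
    case: (@arg_maxnP _ i0 (fun i => (j <= i)%N && (p i < c)) (@nat_of_ord n)).
      by rewrite ji0.
    by move=> s; exists s.
  have sk : (s <= k)%N.
    by rewrite leqNgt; apply/negP => /ltnW/p_homo; rewrite leNgt ps.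
  have s_end : forall i : 'I_n, (s < i)%N -> p s < p i.
    move=> i si; apply: lt_le_trans ps _; rewrite leNgt; apply/negP => ic.
    by have := smax i; rewrite (leq_trans js (ltnW si)) ic leqNgt si => /(_ isT).
  have As : A k = A s.
    apply: sum_itv_extend sk _ => i /andP[si ik].
    apply/eqP; rewrite subr_eq0 eq_le p_homo//= leNgt; apply/negP => ic.
    by have := smax i; rewrite (leq_trans js (ltnW si)) ic leqNgt si => /(_ isT).
  have [|fs|fl] := @radius_concave R (A k) L (nobs j s) (nobs j k) (nobs j l)
    A_le0 _ (nobs_le _ _ kl).
  - by rewrite nobs_gt0 nobs_le.
  - by exists s => //; rewrite !fE// -As lerD2r.
  - by exists l => //; rewrite !fE// Al lerD2r.
(* Here no index from j on has a level below [c]: the interval from j to k lies in one block, [A]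
   vanishes, and lengthening the interval can only shrink the radius. *)
exists l => //; rewrite !fE// Al lerD2r.
have -> : A k = 0.
  apply: big1 => i /andP[ji ik]; apply/eqP; rewrite subr_eq0 eq_le p_homo//=.
  by rewrite leNgt; apply/negP => ic; apply: none; exists i; rewrite ji.
rewrite !mul0r !add0r.
(* For negative [L] both radii are 0, the value of [Num.sqrt] at negative arguments. *)
have [L0|L0] := leP 0 L; last first.
  by rewrite !ler0_sqrtr// pmulr_lle0 ?invr_gt0 ?mulr_gt0 ?ltr0n ?(ltW L0).
rewrite ler_wsqrtr// ler_wpM2l// lef_pV2 ?posrE ?mulr_gt0 ?ltr0n//.
by rewrite ler_pM2l// ler_nat nobs_le.
Qed.

(** Reversing the indices and negating p preserves monotonicity and exchanges left and right ends,
    so the previous lemma applies. *)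
Lemma mean_radius_block_start (R : realType) (n : nat) (p : 'I_n -> R) (L : R)
    (j k : 'I_n) :
  (forall i i' : 'I_n, (i <= i')%N -> p i <= p i') -> (j <= k)%N ->
  let f (l : 'I_n) := (\sum_(i < n | (l <= i <= k)%N) p i) / (nobs l k)%:R
    - Num.sqrt (L / (2 * (nobs l k)%:R)) in
  exists2 l : 'I_n, (l <= k)%N /\ (forall i : 'I_n, (i < l)%N -> p i < p l)
    & f j <= f l.
Proof.
move=> p_homo jk f.
have le_rev (i i' : 'I_n) : (rev_ord i <= rev_ord i')%N = (i' <= i)%N.
  by rewrite /= leq_sub2lE// ltnS.
have nobs_rev (l : 'I_n) : (l <= k)%N -> nobs (rev_ord k) (rev_ord l) = nobs l k.
  by move=> lk; have := ltn_ord k; rewrite /nobs/=; lia.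
have p'_homo (i i' : 'I_n) : (i <= i')%N -> - p (rev_ord i) <= - p (rev_ord i').
  by move=> ii'; rewrite lerN2 p_homo// le_rev.
have rkj : (rev_ord k <= rev_ord j)%N by rewrite le_rev.
have [l [kl l_end]] :=
  @mean_radius_block_end R n (fun i => - p (rev_ord i)) L _ _ p'_homo rkj.
have {kl} rlk : (rev_ord l <= k)%N by rewrite -le_rev rev_ordK.
have sum_rev (a : 'I_n) : \sum_(i < n | (rev_ord k <= i <= rev_ord a)%N) - p (rev_ord i)
    = - \sum_(i < n | (a <= i <= k)%N) p i.
  rewrite sumrN (reindex_inj rev_ord_inj)/=; congr (- _).
  by apply: eq_big => [i|i _]; rewrite ?rev_ordK// -!/(rev_ord _) !le_rev andbC.
rewrite -{1 2 3}(rev_ordK l) !sum_rev !nobs_rev// !mulNr => fl.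
exists (rev_ord l); last by rewrite /f; lra.
split=> // i il; rewrite -ltrN2 -{1}(rev_ordK i) l_end//.
by rewrite -[l]rev_ordK ltnNge le_rev -ltnNge.
Qed.

(** * Optimality conditions for the isotonic estimator *)

Section IsotonicEstimator.
Variables (R : realType) (n : nat) (x : 'I_n -> R) (Y : 'I_n -> bool).
Variable p : R -> R.
Hypothesis x_nondecr : forall i j : 'I_n, (i <= j)%N -> x i <= x j.
Hypothesis pP : isotonic_estimator x Y p.

Let p_homo : {homo p : s t / s <= t}. Proof. by case: pP => -[]. Qed.

(** The observations are 0 or 1, so projecting a value onto [0, 1] does not move it away from
    them. *)
Lemma sq_loss_clip (g : R -> R) :
  sq_loss x Y (fun t => Num.max 0 (Num.min 1 (g t))) <= sq_loss x Y g.
Proof.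
apply: ler_sum => i _; set a := g (x i).
have : ((Y i)%:R == 0 :> R) || ((Y i)%:R == 1 :> R) by case: (Y i); rewrite eqxx ?orbT.
case: (leP 1 a) => a1; first by rewrite (max_idPr ler01) => /orP[] /eqP->; nra.
by case: (leP 0 a) => a0 //; move=> /orP[] /eqP->; nra.
Qed.

(** Clipping removes the range constraint, so that later perturbations of p may leave [0, 1]. *)
Lemma sq_loss_min (g : R -> R) : {homo g : s t / s <= t} ->
  sq_loss x Y p <= sq_loss x Y g.
Proof.
move=> gh; apply: le_trans (sq_loss_clip g); case: pP => _; apply; split.
  by move=> s t st; rewrite le_max2// le_min2// gh.
by move=> t; rewrite le_max lexx/= ge_max ler01/= ge_min lexx.
Qed.

(** First-order condition for a convex problem: the segment from p to g consists of isotonic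
    functions, so the loss cannot decrease to first order along it. *)
Lemma variational_ineq (g : R -> R) : {homo g : s t / s <= t} ->
  0 <= \sum_(i < n) (p (x i) - (Y i)%:R) * (g (x i) - p (x i)).
Proof.
move=> gh; set S := \sum_(i < n) _.
pose Q := \sum_(i < n) (g (x i) - p (x i)) ^+ 2.
have Q0 : 0 <= Q by apply: sumr_ge0 => i _; exact: sqr_ge0.
have key e : 0 <= e <= 1 -> 0 <= 2 * e * S + e ^+ 2 * Q.
  move=> /andP[e0 e1].
  have -> : 2 * e * S + e ^+ 2 * Q =
      sq_loss x Y (fun t => p t + e * (g t - p t)) - sq_loss x Y p.
    rewrite /S /Q /sq_loss !mulr_sumr -big_split -sumrB/=.
    by apply: eq_bigr => i _; ring.
  rewrite subr_ge0; apply: sq_loss_min => s t st.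
  have := ler_wpM2l e0 (gh _ _ st).
  have e1' : 0 <= 1 - e by lra.
  have := ler_wpM2l e1' (p_homo st); lra.
rewrite leNgt; apply/negP => S0.
have QS : 0 < Q - S by lra.
(* This step lies in (0, 1] even when [Q] is 0, and makes 2 S + e Q equal to S + e S, which is
   negative. *)
set e := - S / (Q - S).
have eE : e * (Q - S) = - S by rewrite /e divfK// gt_eqF.
have e0 : 0 < e by rewrite divr_gt0// oppr_gt0.
have e1 : e <= 1 by rewrite ler_pdivrMr//; lra.
have h : 0 <= 2 * e * S + e ^+ 2 * Q by apply: key; rewrite (ltW e0).
have : 0 <= e * (2 * S + e * Q) by lra.
rewrite pmulr_rge0// => h2.
have : e * Q = - S + e * S by lra.
have : e * S < 0 by rewrite pmulr_rlt0.
lra.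
Qed.

(** The variational inequality is tested with p raised by a constant on exactly the indices j..k.
    The jump of x at j lets the raise start there; the jump of p after k leaves room for it. *)
Lemma block_sum_le (j k : 'I_n) : (j <= k)%N ->
  (forall i : 'I_n, (i < j)%N -> x i < x j) ->
  (forall i : 'I_n, (k < i)%N -> p (x k) < p (x i)) ->
  \sum_(i < n | (j <= i <= k)%N) (Y i)%:R <= Ziso x p j k.
Proof.
move=> jk xj pk.
(* [c] is the value of p at the index after k. If k is last, any number above [p (x k)] will do,
   even one beyond 1. *)
have [c pkc cp] : exists2 c, p (x k) < c & forall i : 'I_n, (k < i)%N -> c <= p (x i).
  have [[i ki]|none] := pselect (exists i : 'I_n, (k < i)%N).
    have kn := leq_ltn_trans ki (ltn_ord i).
    exists (p (x (Ordinal kn))); first exact: pk.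
    by move=> i' ki'; rewrite p_homo// x_nondecr.
  exists (p (x k) + 1); first by rewrite ltrDl.
  by move=> i ki; case: none; exists i.
(* [g] raises [p] by [d] on the indices j..k; the cap [c] keeps it isotonic. *)
pose d := c - p (x k).
pose g t := if x j <= t then Num.max (p t) (Num.min (p t + d) c) else p t.
have gh : {homo g : s t / s <= t}.
  move=> s t st; rewrite /g; have := p_homo st.
  case: ifPn => js.
    by rewrite (le_trans js st) => pst; rewrite le_max2// le_min2// lerD2r.
  by case: ifPn => // _ pst; rewrite le_max pst.
have d0 : 0 < d by rewrite subr_gt0.
have := variational_ineq gh.
rewrite (bigID (fun i : 'I_n => (j <= i <= k)%N))/= [X in _ + X]big1 => [|i].
  rewrite addr0 (eq_bigr (fun i : 'I_n => (p (x i) - (Y i)%:R) * d)).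
    by rewrite -mulr_suml pmulr_lge0// sumrB subr_ge0.
  move=> i /andP[ji ik]; congr (_ * _).
  rewrite /g x_nondecr//.
  have pik := p_homo (x_nondecr ik).
  have -> : Num.min (p (x i) + d) c = p (x i) + d by apply/min_idPl; rewrite /d; lra.
  have -> : Num.max (p (x i)) (p (x i) + d) = p (x i) + d by apply/max_idPr; lra.
  lra.
rewrite negb_and -!ltnNge => /orP[ij|ki].
  by rewrite /g leNgt xj// subrr mulr0.
rewrite /g; case: ifPn => _; last by rewrite subrr mulr0.
have -> : Num.min (p (x i) + d) c = c by apply/min_idPr; have := cp _ ki; lra.
have -> : Num.max (p (x i)) c = p (x i) by apply/max_idPl; exact: cp.
by rewrite subrr mulr0.
Qed.

(** Mirror image: p is lowered on j..k, the jump of x after k lets the lowering stop there, and the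
    jump of p at j leaves room for it. *)
Lemma block_sum_ge (j k : 'I_n) : (j <= k)%N ->
  (forall i : 'I_n, (k < i)%N -> x k < x i) ->
  (forall i : 'I_n, (i < j)%N -> p (x i) < p (x j)) ->
  Ziso x p j k <= \sum_(i < n | (j <= i <= k)%N) (Y i)%:R.
Proof.
move=> jk xk pj.
have [c pjc cp] : exists2 c, c < p (x j) & forall i : 'I_n, (i < j)%N -> p (x i) <= c.
  have [[i ij]|none] := pselect (exists i : 'I_n, (i < j)%N).
    have j1n : (j.-1 < n)%N by rewrite (leq_ltn_trans (leq_pred _) (ltn_ord j)).
    have j1j : (j.-1 < j)%N by rewrite prednK// (leq_ltn_trans (leq0n _) ij).
    exists (p (x (Ordinal j1n))); first exact: pj.
    move=> i' ij'; rewrite p_homo// x_nondecr//=.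
    by rewrite -ltnS (ltn_predK j1j).
  exists (p (x j) - 1); first by rewrite gtrBl.
  by move=> i ij; case: none; exists i.
pose d := p (x j) - c.
(* The floor [c], which lies above the values of p before j, keeps the lowered function isotonic. *)
pose g t := if t <= x k then Num.min (p t) (Num.max (p t - d) c) else p t.
have gh : {homo g : s t / s <= t}.
  move=> s t st; rewrite /g; have := p_homo st.
  case: (leP t (x k)) => [tk|_].
    by rewrite (le_trans st tk) => pst; rewrite le_min2// le_max2// lerD2r.
  by case: ifPn => // _ pst; rewrite ge_min pst.
have d0 : 0 < d by rewrite subr_gt0.
have := variational_ineq gh.
rewrite (bigID (fun i : 'I_n => (j <= i <= k)%N))/= [X in _ + X]big1 => [|i].
  rewrite addr0 (eq_bigr (fun i : 'I_n => (p (x i) - (Y i)%:R) * - d)).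
    by rewrite -mulr_suml mulrN oppr_ge0 pmulr_lle0// sumrB subr_le0.
  move=> i /andP[ji ik]; congr (_ * _).
  rewrite /g x_nondecr//.
  have pji := p_homo (x_nondecr ji).
  have -> : Num.max (p (x i) - d) c = p (x i) - d by apply/max_idPl; rewrite /d; lra.
  have -> : Num.min (p (x i)) (p (x i) - d) = p (x i) - d by apply/min_idPr; lra.
  lra.
rewrite negb_and -!ltnNge => /orP[ij|ki]; last first.
  by rewrite /g leNgt xk// subrr mulr0.
rewrite /g; case: ifPn => _; last by rewrite subrr mulr0.
have -> : Num.max (p (x i) - d) c = c by apply/max_idPr; have := cp _ ij; lra.
have -> : Num.min (p (x i)) c = p (x i) by apply/min_idPl; exact: cp.
by rewrite subrr mulr0.
Qed.

End IsotonicEstimator.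

(** * Infima and suprema with default values, and admissible pairs *)

Lemma infimum_le (R : realType) (x0 l : R) (A : set R) (a : R) :
  lbound A l -> A a -> infimum x0 A <= a.
Proof.
move=> Al Aa; rewrite /infimum; case: ifPn => [/eqP A0|_]; first by rewrite A0 in Aa.
(* For a nonempty set bounded below, [inf A] is a greatest lower bound, so [xget] does not fall back
   on its default. *)
have Ai : has_inf A by split; [exists a|exists l].
case: xgetP => [y _ [lb_y _]|/(_ (inf A)) none]; first exact: lb_y.
case: none; split; first exact: inf_lbound (proj2 Ai).
by move=> y; exact: lb_le_inf (proj1 Ai).
Qed.

Lemma le_infimum (R : realType) (x0 v : R) (A : set R) :
  (A = set0 -> v <= x0) -> lbound A v -> v <= infimum x0 A.
Proof.
move=> vx0 Av; have [A0|/set0P[a Aa]] := eqVneq A set0.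
  by rewrite /infimum A0 eqxx vx0.
have Ai : has_inf A by split; [exists a|exists v].
rewrite /infimum ifN; last by apply/set0P; exists a.
case: xgetP => [y _ [_]|/(_ (inf A)) none]; first exact.
case: none; split; first exact: inf_lbound (proj2 Ai).
by move=> y; exact: lb_le_inf (proj1 Ai).
Qed.

Lemma le_supremum (R : realType) (x0 u : R) (A : set R) (a : R) :
  ubound A u -> A a -> a <= supremum x0 A.
Proof.
move=> Au Aa; apply: ge_supremum_Nmem => //.
have As : has_sup A by split; [exists a|exists u].
exists (sup A); split; first exact: sup_ubound (proj2 As).
by move=> y; exact: ge_sup (proj1 As).
Qed.

Lemma supremum_le (R : realType) (x0 v : R) (A : set R) :
  (A = set0 -> x0 <= v) -> ubound A v -> supremum x0 A <= v.
Proof.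
move=> vx0 Av; have [A0|/set0P[a Aa]] := eqVneq A set0.
  by rewrite /supremum A0 eqxx vx0.
have As : has_sup A by split; [exists a|exists v].
rewrite /supremum ifN; last by apply/set0P; exists a.
case: xgetP => [y _ [_]|/(_ (sup A)) none]; first exact.
case: none; split; first exact: sup_ubound (proj2 As).
by move=> y; exact: ge_sup (proj1 As).
Qed.

(** By monotonicity a strict comparison with the neighbour extends to all indices on that side; at
    the ends the infinite sentinels match a vacuous condition. *)
Lemma JsetP (R : realType) (n : nat) (x : 'I_n -> R) (j k : 'I_n) :
  (forall i i' : 'I_n, (i <= i')%N -> x i <= x i') ->
  Jset x (j, k) <-> [/\ (j <= k)%N,
    forall i : 'I_n, (i < j)%N -> x i < x j &
    forall i : 'I_n, (k < i)%N -> x k < x i].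
Proof.
move=> x_nondecr; have xbarS (i : 'I_n) : xbar x i.+1 = (x i)%:E by rewrite /= valK.
rewrite /Jset /= -/(xbar x j.+1) -/(xbar x k.+1) -/(xbar x k.+2) !xbarS.
split=> -[jk xj xk]; split=> //.
- move=> i ij.
  have j1n : (j.-1 < n)%N by rewrite (leq_ltn_trans (leq_pred _) (ltn_ord j)).
  (* [xbar] is shifted by one: at a positive j it holds the value of x at the predecessor of j. *)
  have jE : (j : nat) = (Ordinal j1n).+1 by rewrite /= (ltn_predK ij).
  move: xj; rewrite {1}jE xbarS lte_fin; apply: le_lt_trans; apply: x_nondecr.
  by rewrite -ltnS -jE.
- move=> i ki; have kn := leq_ltn_trans ki (ltn_ord i).
  move: xk; rewrite -[k.+1]/(nat_of_ord (Ordinal kn)) xbarS lte_fin => /lt_le_trans; apply.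
  exact: x_nondecr.
- case: {-1}(nat_of_ord j) (erefl (nat_of_ord j)) => [|j'] jE; first exact: ltNyr.
  have j'n : (j' < n)%N by rewrite (ltn_trans _ (ltn_ord j))// jE.
  by rewrite -[j']/(nat_of_ord (Ordinal j'n)) xbarS lte_fin xj//= jE.
- rewrite /=; case: insubP => [i _ iE|_]; last exact: ltry.
  by rewrite lte_fin xk// -[nat_of_ord i]/(val i) iE.
Qed.

Lemma Zsum_le_nobs (n : nat) (Y : 'I_n -> bool) (j k : 'I_n) :
  (j <= k)%N -> (Zsum Y j k <= nobs j k)%N.
Proof.
by move=> jk; rewrite -card_ord_itv//; apply: leq_sum => i _; exact: leq_b1.
Qed.

(** * Comparison of the bands *)

Section Comparison.
Variables (R : realType) (n : nat) (x : 'I_n -> R) (Y : 'I_n -> bool).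
Variables (p : R -> R) (alpha : R).
Hypothesis x_nondecr : forall i j : 'I_n, (i <= j)%N -> x i <= x j.
Hypothesis pP : isotonic_estimator x Y p.
Hypothesis alpha01 : 0 < alpha < 1.

Let p_homo : {homo p : s t / s <= t}. Proof. by case: pP => -[]. Qed.
Let p01 t : 0 <= p t <= 1. Proof. by case: pP => -[]. Qed.
Let px_homo (i j : 'I_n) : (i <= j)%N -> p (x i) <= p (x j).
Proof. by move=> /x_nondecr/p_homo. Qed.

Let x_lt (i j : 'I_n) : p (x i) < p (x j) -> x i < x j.
Proof. by move=> pij; rewrite ltNge; apply: contraTN pij => /p_homo; rewrite -leNgt. Qed.

Let nobs_gt0 (j k : 'I_n) : (0 < nobs j k)%N. Proof. by rewrite /nobs addn1. Qed.

(** The index j witnesses that there is an observation, hence N >= 1 and N^2 + N >= 2. *)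
Let delta01 (j : 'I_n) : 0 < alpha / Nfactor x < 1.
Proof.
have N0 : (0 < ndistinct x)%N.
  rewrite /ndistinct -has_predT; apply/hasP; exists (x j) => //.
  by rewrite mem_undup codom_f.
have N1 : 1 < Nfactor x by rewrite /Nfactor ltr1n; nia.
have [a0 a1] := andP alpha01; have NP := lt_trans ltr01 N1.
by rewrite divr_gt0//= ltr_pdivrMr// mul1r (lt_trans a1).
Qed.

Let cp_upper_bound (j k : 'I_n) :
  0 <= cp_upper (alpha / Nfactor x) (Zsum Y j k) (nobs j k)
    <= (Zsum Y j k)%:R / (nobs j k)%:R + YB_radius x alpha (nobs j k).
Proof.
by have := cp_upper_le (Zsum Y j k) (delta01 j) (nobs_gt0 j k); rewrite invf_div.
Qed.

Let cp_lower_bound (j k : 'I_n) : (j <= k)%N ->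
  (Zsum Y j k)%:R / (nobs j k)%:R - YB_radius x alpha (nobs j k)
    <= cp_lower (alpha / Nfactor x) (Zsum Y j k) (nobs j k) <= 1.
Proof.
move=> jk.
by have := cp_lower_ge (delta01 j) (nobs_gt0 j k) (Zsum_le_nobs Y jk); rewrite invf_div.
Qed.

Let ZsumE (j k : 'I_n) :
  (Zsum Y j k)%:R = \sum_(i < n | (j <= i <= k)%N) (Y i)%:R :> R.
Proof. by rewrite natr_sum. Qed.

Let sum_const (c : R) (j k : 'I_n) : (j <= k)%N ->
  \sum_(i < n | (j <= i <= k)%N) c = c * (nobs j k)%:R.
Proof.
move=> jk; rewrite -card_ord_itv// natr_sum mulr_sumr.
by apply: eq_bigr => i _; rewrite mulr1.
Qed.

Lemma U_raw_le_U_YB t : U_raw x Y alpha t <= U_YB x p alpha t.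
Proof.
apply: le_infimum => [/image_set0_set0 B0|
    _ [[j k] /= [/(JsetP j k x_nondecr)[jk xj _] tj] <-]].
  (* Without admissible pairs both infima equal 1. *)
  by rewrite /U_raw B0 image_set0 /infimum eqxx.
(* The left end j is kept, so t <= [x j] persists; a jump of p after l forces a jump of x, so (j, l)
   is admissible. *)
have [l [jl pl]] := mean_radius_block_end (ln (Nfactor x / alpha)) px_homo jk.
apply: le_trans; apply: (@le_trans _ _
  ((Zsum Y j l)%:R / (nobs j l)%:R + YB_radius x alpha (nobs j l))).
  have [_ ub] := andP (cp_upper_bound j l); apply: le_trans ub.
  apply: (@infimum_le _ _ 0) => [_ [[j' k'] _ <-]|].
    by case/andP: (cp_upper_bound j' k').
  by exists (j, l) => //; split=> //; apply/(JsetP j l x_nondecr); split=> // i /pl/x_lt.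
rewrite lerD2r ler_pM2r ?invr_gt0 ?ltr0n// ZsumE.
exact: (block_sum_le x_nondecr pP jl xj pl).
Qed.

Lemma L_YB_le_L_raw t : L_YB x p alpha t <= L_raw x Y alpha t.
Proof.
apply: supremum_le => [/image_set0_set0 B0|
    _ [[j k] /= [/(JsetP j k x_nondecr)[jk _ xk] kt] <-]].
  by rewrite /L_raw B0 image_set0 /supremum eqxx.
(* Now the right end k is kept, which preserves [x k] <= t. *)
have [l [lk pl]] := mean_radius_block_start (ln (Nfactor x / alpha)) px_homo jk.
move=> /le_trans; apply.
apply: (@le_trans _ _
  ((Zsum Y l k)%:R / (nobs l k)%:R - YB_radius x alpha (nobs l k))).
  rewrite lerD2r ler_pM2r ?invr_gt0 ?ltr0n// ZsumE.
  exact: (block_sum_ge x_nondecr pP lk xk pl).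
have [lb _] := andP (cp_lower_bound lk); apply: le_trans lb _.
apply: (@le_supremum _ _ 1) => [_ [[j' k'] [/(JsetP j' k' x_nondecr)[jk' _ _] _] <-]|].
  by case/andP: (cp_lower_bound jk').
by exists (l, k) => //; split=> //; apply/(JsetP l k x_nondecr); split=> // i /pl/x_lt.
Qed.

(** For t <= [x j], p t is at most p at [x j], hence at most the mean of p over any interval
    starting at j; the default 1 also dominates p. *)
Lemma isotonic_le_U_YB t : p t <= U_YB x p alpha t.
Proof.
apply: le_infimum => [_|_ [[j k] /= [/(JsetP j k x_nondecr)[jk _ _] tj] <-]].
  by case/andP: (p01 t).
rewrite (le_trans (p_homo tj))// (le_trans (_ : _ <= Ziso x p j k / (nobs j k)%:R))//.
  rewrite ler_pdivlMr ?ltr0n// -sum_const//.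
  by apply: ler_sum => i /andP[ji _]; exact: px_homo.
by rewrite lerDl sqrtr_ge0.
Qed.

Lemma L_YB_le_isotonic t : L_YB x p alpha t <= p t.
Proof.
apply: supremum_le => [_|_ [[j k] /= [/(JsetP j k x_nondecr)[jk _ _] kt] <-]].
  by case/andP: (p01 t).
rewrite (le_trans _ (p_homo kt))// (le_trans (_ : _ <= Ziso x p j k / (nobs j k)%:R))//.
  by rewrite gerBl sqrtr_ge0.
rewrite ler_pdivrMr ?ltr0n// -sum_const//.
by apply: ler_sum => i /andP[_ ik]; exact: px_homo.
Qed.

End Comparison.

Unset Implicit Arguments.
Set Strict Implicit.

Theorem theorem2 (R : realType) (n : nat) (x : 'I_n -> R)
  (x_nondecr : forall i j : 'I_n, (i <= j)%N -> x i <= x j)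
  (alpha : R) (alpha01 : 0 < alpha < 1)
  (Y : 'I_n -> bool)
  (phat : R -> R) (phatP : isotonic_estimator x Y phat) (t : R) :
  (L_YB x phat alpha t <= L_nc x Y phat alpha t /\
   L_nc x Y phat alpha t <= L_raw x Y alpha t) /\
  (U_raw x Y alpha t <= U_nc x Y phat alpha t /\
   U_nc x Y phat alpha t <= U_YB x phat alpha t).
Proof.
split; split.
- by rewrite le_min (L_YB_le_L_raw x_nondecr phatP alpha01)
    (L_YB_le_isotonic alpha x_nondecr phatP).
- by rewrite ge_min lexx.
- by rewrite le_max lexx.
- by rewrite ge_max (U_raw_le_U_YB x_nondecr phatP alpha01)
    (isotonic_le_U_YB alpha x_nondecr phatP).
Qed.
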